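(* Let $\mathcal{N}$, $\tilde{\mathcal{N}}$ be admissible algebras with admissible projections $\pi$, $\tilde\pi$, respectively. Assume that at least one of $\mathcal{N}$, $\tilde{\mathcal{N}}$ admits a grading. Then the algebras $\mathcal{N}$, $\tilde{\mathcal{N}}$ are isomorphic if and only if the hypersurfaces $S_\pi\subset\mathcal{N}$, $S_{\tilde\pi}\subset\tilde{\mathcal{N}}$ are linearly equivalent.
   Context: All algebras are over $\mathbb{C}$. A finite-dimensional commutative associative algebra $\mathcal{N}$ is nilpotent if $\mathcal{N}^{\nu+1}=0$ for some $\nu\ge 0$, where $\mathcal{N}^1:=\mathcal{N}$ and $\mathcal{N}^{j+1}$ is the linear span of $\mathcal{N}\,\mathcal{N}^j$. It is admissible if it is nilpotent and its annihilator $\mathrm{Ann}(\mathcal{N}):=\{u\in\mathcal{N}:u\,\mathcal{N}=0\}$ has dimension 1. An admissible projection on $\mathcal{N}$ is a linear projection $\pi:\mathcal{N}\to\mathrm{Ann}(\mathcal{N})$ with range $\mathrm{Ann}(\mathcal{N})$. $\mathcal{N}$ admits a grading if $\mathcal{N}=\bigoplus_{j>0}\mathcal{N}_j$ for linear subspaces $\mathcal{N}_j$ (indexed by positive integers) with $\mathcal{N}_j\mathcal{N}_m\subset\mathcal{N}_{j+m}$. Let $\mathcal{N}^0:=\mathbb{C}\oplus\mathcal{N}$ be the unital extension of $\mathcal{N}$, and extend $\pi$ to $\mathcal{N}^0$ linearly by $\pi(1)=0$. Let $Q'_\pi:=\{w\in 1+\mathcal{N}:\pi(w^2)=0\}$,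 an affine quadric in $1+\mathcal{N}$, and let $\log:1+\mathcal{N}\to\mathcal{N}$, $\log(1+u):=\sum_{m\ge1}\frac{(-1)^{m+1}}{m}u^m$, which is the inverse of the map $\exp:\mathcal{N}\to1+\mathcal{N}$, $\exp(u)=1+\sum_{m\ge1}\frac{u^m}{m!}$ (all sums are finite). Define $S_\pi:=\log(Q'_\pi)\subset\mathcal{N}$. Equivalently, $S_\pi=\{u\in\mathcal{N}:\pi(\exp_1(2u))=0\}$, where $\exp_1(u):=\sum_{m\ge1}\frac{u^m}{m!}$. Two hypersurfaces in complex vector spaces are linearly equivalent if there is a complex linear isomorphism between the ambient spaces mapping one onto the other. Isomorphic means isomorphic as associative complex algebras. *)

(* Defs.v *)
From HB Require Import structures.
From mathcomp Require Import all_boot all_order all_algebra.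
From mathcomp Require Import classical_sets.

Set Implicit Arguments.
Unset Strict Implicit.
Unset Printing Implicit Defensive.

Import GRing.Theory.
Local Open Scope ring_scope.
Local Open Scope classical_set_scope.

(* Finite-dimensional commutative associative algebras, not assumed unital:
   MathComp's own algebra structures all have a unit, so they do not apply
   (a nonzero nilpotent algebra never has one). *)
HB.mixin Record Vector_isNuComAlg (K : fieldType) N of Vector K N := {
  amul : N -> N -> N;
  amulA : associative amul;
  amulC : commutative amul;
  amulDl : left_distributive amul +%R;
  amulZl : forall (a : K) (u v : N), amul (a *: u) v = a *: amul u v
}.

#[short(type="nuComAlgType")]
HB.structure Definition NuComAlg (K : fieldType) :=
  { N of Vector_isNuComAlg K N & Vector K N }.

Declare Scope nualg_scope.
Delimit Scope nualg_scope with A.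
Notation "u ** v" := (amul u v) (at level 40, left associativity) : nualg_scope.
Local Open Scope nualg_scope.

Section BasicTheory.
Variables (K : fieldType) (N : nuComAlgType K).
Implicit Types u v w : N.

Lemma amulDr u v w : u ** (v + w) = u ** v + u ** w.
Proof. by rewrite ![u ** _]amulC amulDl. Qed.

Lemma amulZr (a : K) u v : u ** (a *: v) = a *: (u ** v).
Proof. by rewrite ![u ** _]amulC amulZl. Qed.

Lemma amul_is_linear u : linear (amul u).
Proof. by move=> a v w; rewrite amulDr amulZr. Qed.

HB.instance Definition _ u :=
  GRing.isLinear.Build K N N _ (amul u) (amul_is_linear u).

Definition lmul u : 'End(N) := linfun (amul u).

Lemma lmul_is_linear : linear lmul.
Proof.
move=> a u v; apply/lfunP => w.
by rewrite add_lfunE scale_lfunE !lfunE /= amulDl amulZl.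
Qed.

HB.instance Definition _ :=
  GRing.isLinear.Build K N 'End(N) _ lmul lmul_is_linear.

Lemma amul0l v : 0 ** v = 0.
Proof. by rewrite -[X in X ** v](scale0r (0 : N)) amulZl scale0r. Qed.

Lemma amul0r v : v ** 0 = 0. Proof. by rewrite amulC amul0l. Qed.

Definition ann : {vspace N} := lker (linfun lmul).

Lemma mem_annP u : reflect (forall v, u ** v = 0) (u \in ann).
Proof.
rewrite memv_ker lfunE /=; apply: (iffP eqP) => [u0 v | u0].
  by move/lfunP/(_ v): u0; rewrite lfunE zero_lfunE.
by apply/lfunP => v; rewrite lfunE zero_lfunE /= u0.
Qed.

Definition lin_span (A : set N) : set N :=
  [set x | forall U : {vspace N}, (forall a, A a -> a \in U) -> x \in U].

(* [alg_pow k] is the power of N with exponent k + 1. *)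
Fixpoint alg_pow (k : nat) : set N :=
  if k is k'.+1 then lin_span [set u ** v | u in [set: N] & v in alg_pow k']
  else [set: N].

Definition nilpotent_alg : Prop := exists nu : nat, alg_pow nu = [set 0].

Definition admissible : Prop := nilpotent_alg /\ \dim ann = 1%N.

Definition admissible_projection (p : 'End(N)) : Prop :=
  (p \o p)%VF = p /\ limg p = ann.

(* [G 0] is never used: the grading is indexed by positive integers.  The
   first two clauses say that N is the direct sum of the whole infinite family:
   finitely many components are always independent, and every element is a
   finite sum of components. *)
Definition has_grading : Prop :=
  exists G : nat -> {vspace N},
    [/\ forall n, directv (\sum_(i < n) G i.+1)%VS,
        forall u, exists n, u \in (\sum_(i < n) G i.+1)%VS
      & forall j m u v, (0 < j)%N -> (0 < m)%N ->
          u \in G j -> v \in G m -> u ** v \in G (j + m)%N].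

End BasicTheory.

Arguments ann {K} N.
Arguments alg_pow {K} N k.
Arguments nilpotent_alg {K} N.
Arguments admissible {K} N.
Arguments admissible_projection {K N} p.
Arguments has_grading {K} N.

Definition unital_ext (K : fieldType) (N : nuComAlgType K) : Type :=
  (K^o * N)%type.

Section UnitalExtension.
Variables (K : fieldType) (N : nuComAlgType K).

HB.instance Definition _ := GRing.Lmodule.copy (unital_ext N) (K^o * N)%type.

Definition uone : unital_ext N := (1, 0).

Definition umul (x y : unital_ext N) : unital_ext N :=
  (x.1 * y.1, (x.1 : K) *: y.2 + (y.1 : K) *: x.2 + x.2 ** y.2).

Lemma umulA : associative umul.
Proof.
move=> [a u] [b v] [c w]; rewrite /umul /=; congr (_, _); first exact: mulrA.
rewrite !scalerDr !amulDl !amulDr !amulZl !amulZr !scalerA amulA.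
rewrite (mulrC (c : K) a) (mulrC (c : K) b) !addrA.
by rewrite [LHS](ACl (1*2*4*6*3*5*7)).
Qed.

Lemma umulC : commutative umul.
Proof.
move=> [a u] [b v]; rewrite /umul /= amulC [in RHS](addrC ((b : K) *: u)).
by congr (_, _); apply: mulrC.
Qed.

Lemma umul1 : left_id uone umul.
Proof.
by move=> [a u]; rewrite /umul /= mul1r scale1r scaler0 addr0 amul0l addr0.
Qed.

Lemma umulDl : left_distributive umul +%R.
Proof.
move=> [a u] [b v] [c w]; rewrite /umul /=; congr (_, _); first exact: mulrDl.
rewrite /= scalerDl scalerDr amulDl !addrA.
by rewrite [RHS](ACl (1*4*2*5*3*6)).
Qed.

Lemma uone_neq0 : uone != 0.
Proof. by apply/eqP => -[/eqP]; rewrite oner_eq0. Qed.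

HB.instance Definition _ := GRing.Zmodule_isComNzRing.Build (unital_ext N)
  umulA umulC umul1 umulDl uone_neq0.

Definition unital_inj (u : N) : unital_ext N := (0, u).

Definition one_plus : set (unital_ext N) :=
  [set 1 + unital_inj u | u in [set: N]].

Definition ext_proj (p : 'End(N)) (x : unital_ext N) : N := p x.2.

Definition Qquadric (p : 'End(N)) : set (unital_ext N) :=
  [set w | one_plus w /\ ext_proj p (w ^+ 2) = 0].

(* Partial sums of the logarithmic series at w = 1 + u; the second projection
   reads a power of u, computed in the unital extension, as an element of N. *)
Definition ulog_upto (n : nat) (w : unital_ext N) : N :=
  \sum_(1 <= m < n.+1) ((-1) ^+ m.+1 / m%:R) *: ((w - 1) ^+ m).2.

(* On 1 + N with N nilpotent, all terms of index larger than dim N vanish (see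
   [ulog_uptoE]), so this is the sum of the whole series. *)
Definition ulog (w : unital_ext N) : N := ulog_upto (\dim {:N}) w.

Definition Shyper (p : 'End(N)) : set N := ulog @` Qquadric p.

Lemma unital_inj_exp (u : N) (m : nat) :
  unital_inj u ^+ m.+1 = unital_inj (iter m (amul u) u).
Proof.
elim: m => [|m IHm]; first by rewrite expr1.
rewrite exprS IHm; congr (_, _) => /=; first by rewrite mul0r.
by rewrite !scale0r !add0r.
Qed.

Lemma alg_pow_iter (u : N) (m : nat) : alg_pow N m (iter m (amul u) u).
Proof.
by elim: m => //= m IHm U sAU; apply: sAU; exists u => //; exists (iter m (amul u) u).
Qed.

Lemma alg_pow_vanish (nu : nat) (u v : N) :
  alg_pow N nu = [set 0] -> iter nu (amul u) v = 0.
Proof.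
move=> Nnu; suff: alg_pow N nu (iter nu (amul u) v) by rewrite Nnu.
elim: (nu) => //= m IHm U sAU.
by apply: sAU; exists u => //; exists (iter m (amul u) v).
Qed.

Lemma nilpotent_iter (u : N) (m : nat) :
  nilpotent_alg N -> (\dim {:N} <= m)%N -> iter m (amul u) u = 0.
Proof.
move=> [nu Nnu] leNm.
pose W := fix W k : {vspace N} := if k is k'.+1 then (lmul u @: W k')%VS else fullv.
have memW k v : iter k (amul u) v \in W k.
  by elim: k => [|k IHk] /=; rewrite ?memvf // -(lfunE (amul u)) memv_img.
have Wdec k : (W k.+1 <= W k)%VS.
  by elim: k => [|k IHk]; [apply: subvf | apply: limgS].
have Wsub k : forall x, x \in W k -> exists v, x = iter k (amul u) v.
  elim: k => [|k IHk] x /=; first by exists x.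
  by case/memv_imgP=> y /IHk[v ->] ->; exists v; rewrite lfunE.
have W0 k : (nu <= k)%N -> W k = 0%VS.
  move=> /subnKC <-; elim: (k - nu)%N => [|j IHj]; last by rewrite addnS /= IHj limg0.
  rewrite addn0; apply/eqP; rewrite -subv0; apply/subvP=> x /Wsub[v ->].
  by rewrite (alg_pow_vanish _ _ Nnu) mem0v.
have Wstab k : W k.+1 = W k -> W k = 0%VS.
  move=> WSk; rewrite -(W0 (nu + k)%N) ?leq_addr //.
  by elim: (nu) => [|j IHj] //=; rewrite -IHj -[LHS]WSk.
have Wdim k : (W k == 0%VS) || (\dim (W k) + k <= \dim {:N})%N.
  elim: k => [|k IHk]; first by rewrite addn0 leqnn orbT.
  have [WSk | neqW] := eqVneq (W k.+1) (W k); first by rewrite WSk (Wstab _ WSk) eqxx.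
  have ltW: (\dim (W k.+1) < \dim (W k))%N.
    by rewrite (ltn_leqif (dimv_leqif_eq (Wdec k))).
  case/orP: IHk => [Wk0 | le_k]; first by rewrite (eqP Wk0) dimv0 in ltW.
  by rewrite addnS -addSn (leq_trans _ le_k) ?orbT // leq_add2r.
have WN: W m = 0%VS.
  apply/eqP; case/orP: (Wdim m) => // le_dim.
  by rewrite -dimv_eq0 -leqn0 -(leq_add2r m) add0n (leq_trans le_dim).
by apply/eqP; rewrite -memv0 -WN memW.
Qed.

Lemma ulog_uptoE (n : nat) (w : unital_ext N) :
  nilpotent_alg N -> one_plus w -> (\dim {:N} <= n)%N ->
  ulog_upto n w = ulog w.
Proof.
move=> Nnil [u _ <-] leNn; rewrite /ulog /ulog_upto.
rewrite (@big_cat_nat _ _ _ (\dim {:N}).+1) //= [X in _ + X]big_nat.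
rewrite [X in _ + X]big1 ?addr0 // => -[//|m] /andP[ltNm _].
by rewrite [1 + _]addrC addrK unital_inj_exp /= nilpotent_iter ?scaler0.
Qed.

End UnitalExtension.

Definition alg_isomorphic (K : fieldType) (N N' : nuComAlgType K) : Prop :=
  exists2 f : {linear N -> N'},
    bijective f & forall u v, f (u ** v) = f u ** f v.

Definition lin_equivalent (K : fieldType) (V V' : vectType K)
    (S : set V) (S' : set V') : Prop :=
  exists2 f : {linear V -> V'}, bijective f & f @` S = S'.

(* Main.v *)
From HB Require Import structures.
Require Import Defs.
From mathcomp Require Import all_boot all_order all_algebra.
From mathcomp Require Import boolp classical_sets reals complex ring.

Set Implicit Arguments.
Unset Strict Implicit.
Unset Printing Implicit Defensive.

Import GRing.Theory Num.Theory.
Local Open Scope ring_scope.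
Local Open Scope nualg_scope.

(** Write P(x) = w(exp(x) - 1), where w is the coordinate of the projection pi
    on a generator a of the annihilator.  Then S_pi is the set of x with
    P(2x) = 0 ([Shyper_exp]); as exp(y + r a) = exp(y) + r a, the zero set of P
    is a graph over any complement of the annihilator.

    From linear equivalence to isomorphism.  Let the linear bijection f carry
    the zeros of P onto those of P'.  For a fixed y the polynomial
    q(r) = P'(f(y) + r f(a)) takes each value at most once: adding a constant to
    P' amounts to translating along the annihilator of N', and the zero set of P
    meets each line parallel to a exactly once.  Hence q has degree 1
    ([injective_poly_size]).  Its slope is a nowhere vanishing polynomial in y,
    hence a constant c, and P' o f = c P ([exp_fun_proportional]).  Comparing
    homogeneous parts gives w'(f(x)^m) = c w(x^m) for all m.  Polarizing for
    m = 2 and 3 shows that f(xy) - f(x)f(y) is killed by w' and is orthogonal to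
    N' for the form (u, v) |-> w'(uv).  Since every nonzero ideal of a nilpotent
    algebra meets the annihilator, no nonzero vector has both properties, and f
    is multiplicative ([moments_morph]).

    From isomorphism to linear equivalence.  An isomorphism that matches the
    kernels of the two projections carries one hypersurface onto the other
    ([Shyper_transport]), so it is enough that the automorphisms of a graded
    algebra act transitively on the functionals w with w(a) = 1.  For any v in N
    the substitution x |-> (1 + v)^j x on the component of degree j is an
    algebra endomorphism.  The annihilator is concentrated in the top degree d, and a
    substitution with v of degree d - m changes w on the component of degree m
    by an arbitrary functional while leaving the higher components alone.
    Descending on m, w is brought to the functional that vanishes in all degrees
    other than d ([graded_normal_form]). *)

(** * Exponential and logarithm modulo a power of the variable *)

Section TruncatedSeries.
Variable K : numFieldType.
Implicit Types A B q r : {poly K}.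

Lemma dvdXnP n A : reflect (forall i, (i < n)%N -> A`_i = 0) ('X^n %| A).
Proof.
apply: (iffP idP) => [/dvdpP[q ->] i ltin | A0]; first by rewrite coefMXn ltin.
rewrite -[A](poly_take_drop n) dvdp_addl ?dvdp_mulIr //.
suff -> : take_poly n A = 0 by apply: dvdp0.
by apply/polyP => i; rewrite coef_take_poly coef0; case: ifP => // /A0.
Qed.

(** Uniqueness for the linear equation A' = B A with A(0) = 0, to finite order:
    the coefficient of degree k of A is 1/k times one that involves only the
    earlier coefficients.  The identities for [exp_poly] and [log_poly]
    below all follow from it, by differentiating the difference of both sides. *)
Lemma ode_uniq n A B :
  A.[0] = 0 -> 'X^n %| A^`() - B * A -> 'X^(n.+1) %| A.
Proof.
move=> A0 /dvdXnP dA; apply/dvdXnP => i lti.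
suff H k : (k <= n.+1)%N -> forall j, (j < k)%N -> A`_j = 0 by apply: (H n.+1).
elim: k => // k IHk ltk j; rewrite ltnS leq_eqVlt => /predU1P[->{j}|ltj];
  last exact: IHk (ltnW ltk) _ ltj.
case: k => [|k] in IHk ltk *; first by rewrite -horner_coef0.
have := dA k ltk; rewrite coefB coef_deriv coefM big1 ?subr0 => [/eqP|l _].
  by rewrite mulrn_eq0 => /eqP.
by rewrite (IHk (ltnW ltk)) ?mulr0 // ltnS leq_subr.
Qed.

Lemma dvdXn_comp n A q : q.[0] = 0 -> 'X^n %| A -> 'X^n %| A \Po q.
Proof.
move=> q0 /(dvdp_comp_poly q); apply: dvdp_trans.
rewrite comp_Xn_poly; apply: dvdp_exp2r; rewrite -['X]expr1.
by apply/dvdXnP => -[|//] _; rewrite -horner_coef0.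
Qed.

Definition exp_poly n : {poly K} := \poly_(k < n.+1) (k`!%:R)^-1.
(** The term of index 0 vanishes because 0 is its own inverse here. *)
Definition log_poly n : {poly K} := \poly_(m < n.+1) ((-1) ^+ m.+1 / m%:R).

Lemma exp_poly0 n : (exp_poly n).[0] = 1.
Proof. by rewrite horner_coef0 coef_poly /= fact0 invr1. Qed.

Lemma log_poly0 n : (log_poly n).[0] = 0.
Proof. by rewrite horner_coef0 coef_poly /= invr0 mulr0. Qed.

Lemma exp_poly_ode n : 'X^n %| (exp_poly n)^`() - exp_poly n.
Proof.
apply/dvdXnP => i ltin; rewrite coefB coef_deriv !coef_poly ltnS ltin ltnW //.
by rewrite -[_ *+ _]mulr_natl factS natrM invfM mulVKf ?subrr ?pnatr_eq0.
Qed.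

Lemma log_poly_ode n : 'X^n %| (1 + 'X) * (log_poly n)^`() - 1.
Proof.
have dL i : (i < n)%N -> (log_poly n)^`()`_i = (-1) ^+ i.
  move=> ltin; rewrite coef_deriv coef_poly ltnS ltin -[_ *+ _]mulr_natr mulfVK.
    by rewrite !exprS !mulN1r opprK.
  by rewrite pnatr_eq0.
apply/dvdXnP => i ltin; rewrite mulrDl mul1r coefB coefD coefXM coef1 dL //.
case: i ltin => [|i] lti; first by rewrite addr0 subrr.
by rewrite dL ?(ltnW lti) // exprS mulN1r addNr subr0.
Qed.

Lemma exp_poly_double n :
  'X^(n.+1) %| exp_poly n ^+ 2 - (exp_poly n \Po (2 *: 'X)).
Proof.
set E := exp_poly n; have X20 : (2 *: 'X : {poly K}).[0] = 0.
  by rewrite hornerZ hornerX mulr0.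
apply: (@ode_uniq n _ 2).
  by rewrite hornerD hornerN horner_comp X20 horner_exp exp_poly0 expr1n subrr.
rewrite derivB deriv_exp deriv_comp derivZ derivX /=.
have -> : (2 *: 1 : {poly K}) = 2 by rewrite scaler_nat.
have -> : E^`() * E ^+ 1 *+ 2 - (E^`() \Po 2 *: 'X) * 2 -
    2 * (E ^+ 2 - (E \Po 2 *: 'X)) =
    (2 * E) * (E^`() - E) - ((E^`() - E) \Po 2 *: 'X) * 2.
  by rewrite comp_polyB; ring.
apply: dvdp_sub; first by apply: dvdp_mull; apply: exp_poly_ode.
by apply/dvdp_mulr/dvdXn_comp => //; apply: exp_poly_ode.
Qed.

Lemma exp_log_poly n :
  'X^(n.+1) %| (exp_poly n \Po log_poly n) - (1 + 'X).
Proof.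
set E := exp_poly n; set L := log_poly n.
apply: (@ode_uniq n _ L^`()).
  by rewrite !hornerE horner_comp log_poly0 exp_poly0 subrr.
rewrite derivB deriv_comp derivD derivX -[1]/(1%:P) derivC add0r.
have -> : (E^`() \Po L) * L^`() - 1 - L^`() * ((E \Po L) - (1 + 'X)) =
   ((E^`() - E) \Po L) * L^`() + ((1 + 'X) * L^`() - 1).
  by rewrite comp_polyB; ring.
apply: dvdp_add; last exact: log_poly_ode.
by apply/dvdp_mulr/dvdXn_comp; [apply: log_poly0 | apply: exp_poly_ode].
Qed.

Lemma log_exp_poly n :
  'X^(n.+1) %| (log_poly n \Po (exp_poly n - 1)) - 'X.
Proof.
set E := exp_poly n; set L := log_poly n.
have E10 : (E - 1).[0] = 0 by rewrite !hornerE exp_poly0 subrr.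
apply: (@ode_uniq n _ 0).
  by rewrite hornerD hornerN hornerX horner_comp E10 log_poly0 subr0.
rewrite derivB deriv_comp derivB derivX -[1]/(1%:P) derivC subr0 mul0r subr0.
have -> : (L^`() \Po (E - 1)) * E^`() - 1 =
   (L^`() \Po (E - 1)) * (E^`() - E) + (((1 + 'X) * L^`() - 1) \Po (E - 1)).
  rewrite !(comp_polyB, comp_polyM, comp_polyD) comp_polyX.
  by rewrite -[1]/(1%:P) !comp_polyC; ring.
apply: dvdp_add; first by apply: dvdp_mull; apply: exp_poly_ode.
by apply: dvdXn_comp => //; apply: log_poly_ode.
Qed.

End TruncatedSeries.

(** * The unital extension and the equation of the hypersurface *)

Section UnitalAlgebra.
Variables (K : fieldType) (N : nuComAlgType K).
Implicit Types (x y : N) (q : {poly K}).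
Let A := unital_ext N.

(** With the algebra structure, polynomials can be evaluated at elements of the
    extension, which turns identities modulo a power of the variable into
    identities between nilpotent elements. *)
Lemma umul_scaleAl (c : K) (u v : A) : c *: (u * v) = c *: u * v.
Proof.
case: u v => [a x] [b y]; congr (_, _); first exact: mulrA.
rewrite /= !scalerDr amulZl !scalerA; congr (_ *: _ + _ *: _ + _).
exact: mulrC.
Qed.

HB.instance Definition _ :=
  GRing.Lmodule_isLalgebra.Build K (unital_ext N) umul_scaleAl.
HB.instance Definition _ := GRing.Lalgebra_isComAlgebra.Build K (unital_ext N).

Lemma unital_inj_is_linear : linear (@unital_inj K N).
Proof.
by move=> c x y; congr (_, _); rewrite /= -[RHS]/(c * 0 + 0) mulr0 addr0.
Qed.

HB.instance Definition _ :=
  GRing.isLinear.Build K N (unital_ext N) _ (@unital_inj K N) unital_inj_is_linear.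

Lemma unital_injM x y : unital_inj x * unital_inj y = unital_inj (x ** y).
Proof. by congr (_, _); rewrite /= ?mulr0 // !scale0r !add0r. Qed.

Lemma unital_injK (z : A) : z.1 = 0 -> unital_inj z.2 = z.
Proof. by case: z => [a x] /= ->. Qed.

Lemma fst_horner_alg x q : (horner_alg (unital_inj x) q).1 = q.[0].
Proof.
elim/poly_ind: q => [|q c IHq]; first by rewrite rmorph0 horner0.
rewrite hornerMXaddC mulr0 add0r rmorphD rmorphM /= horner_algX horner_algC.
by rewrite -[LHS]/(_ * 0 + c * 1) mulr0 mulr1 add0r.
Qed.

Lemma horner_algZ (B : algType K) (z : B) c q :
  horner_alg z (c *: q) = c *: horner_alg z q.
Proof. by rewrite linearZ /= mulr_algl. Qed.

Lemma horner_alg_comp (B : algType K) (z : B) q r :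
  horner_alg z (q \Po r) = horner_alg (horner_alg z r) q.
Proof.
elim/poly_ind: q => [|q c IHq]; first by rewrite comp_poly0 !rmorph0.
by rewrite comp_poly_MXaddC !rmorphD !rmorphM /= IHq !horner_algX !horner_algC.
Qed.

Hypothesis nilN : nilpotent_alg N.

Lemma unital_inj_nilp x m : (\dim {:N} < m)%N -> unital_inj x ^+ m = 0.
Proof.
by case: m => // m ltm; rewrite unital_inj_exp nilpotent_iter // linear0.
Qed.

(** Nilpotency bounds the order of truncation uniformly: all powers beyond the
    dimension vanish. *)
Lemma eq_horner_alg x q r :
  'X^((\dim {:N}).+1) %| q - r ->
  horner_alg (unital_inj x) q = horner_alg (unital_inj x) r.
Proof.
move/dvdpP=> [s]; move/(congr1 (horner_alg (unital_inj x))).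
rewrite rmorphB rmorphM rmorphXn /= horner_algX unital_inj_nilp // mulr0.
by move/eqP; rewrite subr_eq0 => /eqP.
Qed.

End UnitalAlgebra.

Section ExpEquation.
Variables (K : numFieldType) (N : nuComAlgType K) (p : 'End(N)).
Hypothesis nilN : nilpotent_alg N.
Implicit Types (x u : N).

Definition uexp x : unital_ext N :=
  horner_alg (unital_inj x) (exp_poly K (\dim {:N})).

Lemma uexp_nilp x : unital_inj (uexp x - 1).2 = uexp x - 1.
Proof.
apply: unital_injK; rewrite -[LHS]/((uexp x).1 - 1).
by rewrite fst_horner_alg exp_poly0 subrr.
Qed.

Lemma ulogE u :
  unital_inj (ulog (1 + unital_inj u)) =
  horner_alg (unital_inj u) (log_poly K (\dim {:N})).
Proof.
set n := \dim {:N}; rewrite -[RHS]unital_injK; last first.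
  by rewrite fst_horner_alg log_poly0.
congr unital_inj; rewrite /ulog /ulog_upto -/n /log_poly.
rewrite poly_def linear_sum -[RHS]/(@snd K^o N _) raddf_sum.
rewrite -(big_mkord xpredT (fun m => (horner_alg (unital_inj u)
  (((-1) ^+ m.+1 / m%:R) *: 'X^m)).2)) [RHS]big_ltn //.
rewrite invr0 mulr0 scale0r linear0. rewrite -[RHS]/(0 + _) add0r.
apply: eq_big_nat => m _; rewrite horner_algZ rmorphXn /= horner_algX.
by rewrite addrC addKr.
Qed.

(** If x = log(w) then exp(2x) = w^2; conversely w = exp(x) is the only possible
    point of the quadric with logarithm x. *)
Lemma Shyper_exp x : Shyper p x <-> p (uexp (2 *: x)).2 = 0.
Proof.
have -> : uexp (2 *: x) = uexp x ^+ 2.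
  rewrite /uexp -rmorphXn /= (eq_horner_alg nilN _ (exp_poly_double K _)).
  by rewrite horner_alg_comp horner_algZ horner_algX -linearZ.
have expK u : unital_inj (ulog (1 + unital_inj u)) = unital_inj x ->
    uexp x = 1 + unital_inj u.
  rewrite /uexp => <-; rewrite ulogE -horner_alg_comp.
  rewrite (eq_horner_alg nilN _ (exp_log_poly K _)).
  by rewrite rmorphD rmorph1 /= horner_algX.
split=> [[_ [[u _ <-]] pw2 logx] | pexp].
  by rewrite (expK u) // logx.
pose u := (uexp x - 1).2.
have uE : 1 + unital_inj u = uexp x by rewrite uexp_nilp addrC subrK.
exists (uexp x); first by split=> //; exists u.
suff : unital_inj (ulog (uexp x)) = unital_inj x by case.
rewrite -uE ulogE uexp_nilp -(rmorph1 (horner_alg (unital_inj x))) -rmorphB.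
rewrite -horner_alg_comp (eq_horner_alg nilN _ (log_exp_poly K _)).
by rewrite horner_algX.
Qed.

End ExpEquation.

(** * The annihilator as socle, and injective polynomials *)

Section Socle.
Variables (K : fieldType) (N : nuComAlgType K).
Hypothesis nilN : nilpotent_alg N.
Implicit Types (x y a : N) (w : 'Hom(N, K^o)).

(** Multiply x by elements of N as long as the product is nonzero; by nilpotency
    this stops, and it stops in the annihilator. *)
Lemma ann_meets x : x != 0 ->
  exists2 a, a \in ann N /\ a != 0 & a = x \/ exists y, a = x ** y.
Proof.
have [nu Nnu] := nilN.
suff H k z : (k <= nu)%N -> alg_pow N (nu - k) z -> z != 0 ->
    exists2 a, a \in ann N /\ a != 0 & a = z \/ exists y, a = z ** y.
  by apply: (H nu) => //; rewrite subnn.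
elim: k z => [|k IHk] z lek powz z0.
  by move: powz; rewrite subn0 Nnu => z00; rewrite z00 eqxx in z0.
have [az | /mem_annP/existsNP[y /eqP zy0]] := boolP (z \in ann N).
  by exists z => //; left.
case: (IHk (z ** y) (ltnW lek)) => //.
  rewrite -subSS subSn //= => U sAU; apply: sAU.
  by exists y => //; exists z => //; apply: amulC.
move=> a aann aE; exists a => //; right.
by case: aE => [->|[y' ->]]; [exists y | exists (y ** y'); rewrite amulA].
Qed.

Variable a : N.
Hypothesis annN : ann N = <[a]>%VS.

(** Otherwise the ideal generated by x, on which w vanishes, would contain the
    whole annihilator. *)
Lemma ann_pairing_nondeg w x :
  w a != 0 -> w x = 0 -> (forall y, w (x ** y) = 0) -> x = 0.
Proof.
move=> wa0 wx0 wxy0; apply/eqP; apply: contraT => /ann_meets[b []].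
rewrite annN => /vlineP[k ->]; rewrite scaler_eq0 negb_or => /andP[k0 _] kaE.
have /eqP : w (k *: a) = 0 by case: kaE => [-> | [y ->]].
by rewrite linearZ mulf_eq0 (negPf k0) (negPf wa0).
Qed.

(** The form (u, v) |-> w (u ** v) + w u * w v is nondegenerate on N: if v is in
    its kernel, testing against [a] gives w v = 0, and the previous lemma applies
    to v.  Hence it represents every functional, and for those that vanish at [a]
    the second summand disappears. *)
Lemma ann_pairing_onto w (l : 'Hom(N, K^o)) :
  w a = 1 -> l a = 0 -> exists v, forall x, l x = w (v ** x).
Proof.
move=> wa la.
have ann_a x : a ** x = 0 by apply/mem_annP: x; rewrite annN memv_line.
pose Psi v : 'Hom(N, K^o) := (w \o lmul v)%VF + w v *: w.
have PsiE (v x : N) : Psi v x = w (v ** x) + w v * w x.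
  by rewrite add_lfunE scale_lfunE comp_lfunE lfunE.
clearbody Psi.
have Psi_lin : linear Psi.
  move=> c u v; apply/lfunP => x; rewrite add_lfunE scale_lfunE !PsiE.
  rewrite amulDl amulZl !linearP.

  by rewrite /= scalerDr mulrDl scalerAl addrACA.
pose L : {linear N -> 'Hom(N, K^o)} :=
  HB.pack Psi (GRing.isLinear.Build K N 'Hom(N, K^o) _ Psi Psi_lin).
have kerL : lker (linfun L) == 0%VS.
  apply/lker0P => u v; rewrite !lfunE /= => uv; apply/eqP; rewrite -subr_eq0.
  have {}uv x : w ((u - v) ** x) + w (u - v) * w x = 0.
    by rewrite -PsiE -[Psi _]/(L _) linearB /= uv subrr lfunE.
  have wuv : w (u - v) = 0.
    by have := uv a; rewrite amulC ann_a linear0 add0r wa mulr1.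
  apply/eqP/(ann_pairing_nondeg (w := w)); rewrite ?wa ?oner_eq0 // => x.
  by have := uv x; rewrite wuv mul0r addr0.
have imL : limg (linfun L) = fullv.
  apply/eqP; rewrite eqEdim subvf limg_dim_eq ?(eqP kerL) ?capv0 //.
  by rewrite !dimvf /= -[X in (X <= _)%N]/(dim N * 1)%N muln1 leqnn.
have /memv_imgP[v _ lE] : l \in limg (linfun L) by rewrite imL memvf.
exists v => x; have {}lE y : l y = w (v ** y) + w v * w y by rewrite lE lfunE -PsiE.
have wv : w v = 0.
  by move: (lE a); rewrite la amulC ann_a linear0 add0r wa mulr1.
by rewrite lE wv mul0r addr0.
Qed.

End Socle.

Lemma dim1_line (K : fieldType) (V : vectType K) (U : {vspace V}) :
  \dim U = 1%N -> exists2 a, a != 0 & U = <[a]>%VS.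
Proof.
move=> dimU; exists (vpick U).
  by rewrite vpick0 -dimv_eq0 dimU.
apply/esym/eqP; rewrite eqEdim -memvE memv_pick dimU dim_vline vpick0.
by rewrite -dimv_eq0 dimU.
Qed.

Lemma line_coord (K : fieldType) (U V : vectType K) (g : 'Hom(U, V)) (c : V) :
  c != 0 -> (forall x, g x \in <[c]>%VS) ->
  exists w : 'Hom(U, K^o), forall x, g x = w x *: c.
Proof.
move=> c0 gc; pose X := [tuple c].
exists (linfun (coord X ord0 : V -> K^o) \o g)%VF => x.
rewrite comp_lfunE lfunE /= [LHS](coord_span (X := X)) ?big_ord1 //.
by rewrite span_seq1.
Qed.

Section Injective.
Variable C : numClosedFieldType.
Implicit Types q : {poly C}.

(** The only root of q - q(r) is r, with full multiplicity. *)
Lemma injective_poly_shift q r : injective (horner q) -> (1 < size q)%N ->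
  exists2 c, c != 0 & q - q.[r]%:P = c *: ('X - r%:P) ^+ (size q).-1.
Proof.
move=> q_inj sz_q; set q1 := q - _; have [s q1E] := closed_field_poly_normal q1.
have sz_q1 : size q1 = size q.
  by rewrite size_polyDl // size_polyN (leq_ltn_trans (size_polyC_leq1 _)).
have lc0 : lead_coef q1 != 0.
  by rewrite lead_coef_eq0 -size_poly_gt0 sz_q1 (ltn_trans _ sz_q).
have sE : s = nseq (size s) r.
  apply/all_pred1P/allP => z zs /=; apply/eqP/q_inj/eqP.
  have : root q1 z by rewrite q1E rootZ // root_prod_XsubC.
  by rewrite rootE !hornerE subr_eq0.
exists (lead_coef q1) => //; rewrite [LHS]q1E sE big_nseq -Monoid.iteropE.
have <- : size s = (size q).-1; last by [].
by rewrite -sz_q1 q1E size_scale // size_prod_XsubC.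
Qed.

(** By the previous lemma q' is a multiple of X^(m-1) and of (X - 1)^(m-1), with m
    the degree of q; for m > 1 the values at 0 differ. *)
Lemma injective_poly_size q : injective (horner q) -> size q = 2%N.
Proof.
move=> q_inj; have [sz_q | sz_q] := leqP (size q) 1%N.
  have := q_inj 0 1; rewrite (size1_polyC sz_q) !hornerC => /(_ erefl)/eqP.
  by rewrite eq_sym oner_eq0.
have [c0 _ q0E] := injective_poly_shift 0 q_inj sz_q.
have [c1 nz_c1 q1E] := injective_poly_shift 1 q_inj sz_q.
case: (size q) => [//|[//|[//|m]]] /= in sz_q q0E q1E *.
have /(congr1 deriv) := q0E; rewrite derivB derivC subr0 => dq.
have /(congr1 deriv) := q1E; rewrite derivB derivC subr0 dq.
move/(congr1 (horner^~ 0)); rewrite !derivZ !deriv_exp !derivXsubC !hornerZ.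
rewrite !hornerMn !hornerM !horner_exp !hornerXsubC hornerC subrr sub0r.
move/eqP; rewrite /= expr0n !mul1r mul0rn mulr0 eq_sym mulf_eq0 (negPf nz_c1).
by rewrite mulrn_eq0 signr_eq0.
Qed.

End Injective.

(** * The defining function along lines *)

Section ExpFunctional.
Variables (K : numFieldType) (N : nuComAlgType K) (w : 'Hom(N, K^o)).
Hypothesis nilN : nilpotent_alg N.
Implicit Types (x y z a b : N).

Definition exp_fun x : K := w (uexp x).2.

Lemma umul_ann a (z : unital_ext N) :
  a \in ann N -> z * unital_inj a = z.1 *: unital_inj a.
Proof.
move=> /mem_annP aann; congr (_, _).
by rewrite /= scale0r addr0 amulC aann addr0.
Qed.

(** All products of an annihilator element with elements of N vanish, so it enters
    a polynomial through the coefficient of degree 1 alone, which is 1 for the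
    exponential. *)
Lemma uexpD_ann y a : a \in ann N -> uexp (y + a) = uexp y + unital_inj a.
Proof.
move=> aann.
have hornerDa q : horner_alg (unital_inj (y + a)) q =
    horner_alg (unital_inj y) q + q`_1 *: unital_inj a.
  elim/poly_ind: q => [|q c IHq]; first by rewrite !rmorph0 coef0 scale0r addr0.
  rewrite !rmorphD !rmorphM /= !horner_algX !horner_algC IHq.
  rewrite coefD coefMX coefC addr0 /= mulrDl raddfD /= !mulrDr.
  rewrite (umul_ann _ aann) fst_horner_alg horner_coef0 -!scalerAl !unital_injM.
  by rewrite !(mem_annP _ aann) linear0 !addr0 addrAC.
rewrite /uexp hornerDa coef_poly.
have [->|a0] := eqVneq a 0; first by rewrite !linear0.
rewrite ltnS lt0n dimv_eq0.
have -> : fullv != 0%VS :> {vspace N}.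
  by apply: contra a0 => /eqP N0; rewrite -memv0 -N0 memvf.
by rewrite invr1 scale1r.
Qed.

Lemma exp_funD_ann y a : a \in ann N -> exp_fun (y + a) = exp_fun y + w a.
Proof.
by move=> aann; rewrite /exp_fun uexpD_ann // -[LHS]/(w (_ + _)) linearD.
Qed.

Lemma exp_fun_poly z b : exists q : {poly K},
  forall r, q.[r] = exp_fun (z + r *: b).
Proof.
pose Q : {poly unital_ext N} :=
  map_poly (in_alg (unital_ext N)) (exp_poly K (\dim {:N})) \Po
  ((unital_inj b)%:P * 'X + (unital_inj z)%:P).
exists (\poly_(i < size Q) w (Q`_i).2) => r.
rewrite /exp_fun; have -> : uexp (z + r *: b) = Q.[r%:A].
  rewrite horner_comp hornerMXaddC hornerC mulrC mulr_algl addrC.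
  by rewrite -linearZ -linearD.
rewrite horner_poly horner_coef [(\sum_(i < _) _).2]raddf_sum linear_sum.
apply: eq_bigr => i _; have -> : r%:A ^+ i = (r ^+ i)%:A :> unital_ext N.
  by rewrite -!in_algE rmorphXn.
have mul2 (u : unital_ext N) (c : K) : (u * c%:A).2 = c *: u.2 by rewrite mulr_algr.
by rewrite [RHS](congr1 w (mul2 _ _)) linearZ /= mulrC.
Qed.

(** Restricting to a line through 0 separates the homogeneous parts of [exp_fun],
    so that two such functions can be compared degree by degree. *)
Lemma exp_fun_scale z :
  exists2 q : {poly K}, (forall t, q.[t] = exp_fun (t *: z)) &
    forall m, q`_m = w (unital_inj z ^+ m).2 / m`!%:R.
Proof.
exists (\poly_(m < (\dim {:N}).+1) (w (unital_inj z ^+ m).2 / m`!%:R)).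
  move=> t; rewrite horner_poly /exp_fun /uexp /exp_poly poly_def rmorph_sum.
  rewrite [(\sum_(i < _) _).2]raddf_sum linear_sum.
  apply: eq_bigr => m _; rewrite /= horner_algZ rmorphXn /= horner_algX.
  have -> : unital_inj (t *: z) = t *: unital_inj z by rewrite linearZ.
  rewrite exprZn -[RHS]/(w (_ *: (_ *: _))).
  by rewrite !linearZ /= mulrAC mulrC [_ * t ^+ m]mulrC.
move=> m; rewrite coef_poly; case: ltnP => // ltnm.
by rewrite unital_inj_nilp // linear0 mul0r.
Qed.

End ExpFunctional.

(** * From linear equivalence to isomorphism *)

Section ProportionalExp.
Variables (C : numClosedFieldType) (N N' : nuComAlgType C).
Hypotheses (nilN : nilpotent_alg N) (nilN' : nilpotent_alg N').
Variables (a : N) (a' : N').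
Hypotheses (annN : ann N = <[a]>%VS) (annN' : ann N' = <[a']>%VS).
Variables (w : 'Hom(N, C^o)) (w' : 'Hom(N', C^o)).
Hypotheses (wa : w a = 1) (wa' : w' a' = 1).
Variable f : {linear N -> N'}.
Hypothesis f_bij : bijective f.
Hypothesis f_zeros : forall x, exp_fun w x = 0 <-> exp_fun w' (f x) = 0.

Let ann_a (k : C) : k *: a \in ann N.
Proof. by rewrite annN memvZ ?memv_line. Qed.
Let ann_a' (k : C) : k *: a' \in ann N'.
Proof. by rewrite annN' memvZ ?memv_line. Qed.

Let exp_funDa y k : exp_fun w (y + k *: a) = exp_fun w y + k.
Proof. by rewrite exp_funD_ann // linearZ /= wa [_ *: _]mulr1. Qed.

Let exp_funDa' y k : exp_fun w' (y + k *: a') = exp_fun w' y + k.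
Proof. by rewrite exp_funD_ann // linearZ /= wa' [_ *: _]mulr1. Qed.

Let slope y := exp_fun w' (f y + f a) - exp_fun w' (f y).

(** The polynomial r |-> exp_fun w' (f y + r f(a)) is injective, hence affine of
    nonzero slope, and it vanishes at r = - exp_fun w y. *)
Lemma exp_fun_along_ann y :
  slope y != 0 /\ exp_fun w' (f y) = slope y * exp_fun w y.
Proof.
have [g fK gK] := f_bij.
have [q qE] := exp_fun_poly w' (f y) (f a).
have q_inj : injective (horner q).
  move=> r1 r2 q12.
  (* Subtracting the common value q(r1) is the same as translating by a multiple
     of a' = f (g a'), and the result must be the unique zero of [exp_fun w] on
     a line parallel to a. *)
  have rE r : q.[r] = q.[r1] -> r = - exp_fun w (y - q.[r1] *: g a').
    move=> qr; suff /f_zeros : exp_fun w' (f (y - q.[r1] *: g a' + r *: a)) = 0.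
      by rewrite exp_funDa addrC => /eqP; rewrite addr_eq0 => /eqP.
    rewrite linearD linearB !linearZ /= gK addrAC.
    rewrite scalerN -scaleNr exp_funDa'.
    by rewrite -qE qr subrr.
  by rewrite (rE r1) // [RHS](rE r2).
have sz_q := injective_poly_size q_inj.
have qhorner r : q.[r] = q`_0 + q`_1 * r.
  by rewrite horner_coef sz_q !big_ord_recl big_ord0 expr0 mulr1 expr1 addr0.
have qy : exp_fun w' (f y) = q`_0.
  by have := qE 0; rewrite qhorner mulr0 scale0r !addr0.
have slopeE : slope y = q`_1.
  by rewrite /slope qy -{1}[f a]scale1r -qE qhorner mulr1 addrC addKr.
split.
  rewrite slopeE -[1%N]/(2.-1)%N -sz_q -lead_coefE lead_coef_eq0.
  by rewrite -size_poly_gt0 sz_q.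
have /f_zeros : exp_fun w (y + (- exp_fun w y) *: a) = 0.
  by rewrite exp_funDa subrr.
rewrite linearD linearZ /= -qE qhorner mulrN => /eqP.
rewrite subr_eq0 slopeE => /eqP <-.
exact: qy.
Qed.

(** On the line spanned by x the slope is a polynomial without zeros, hence
    constant. *)
Lemma exp_fun_proportional :
  exists2 c, c != 0 & forall x, exp_fun w' (f x) = c * exp_fun w x.
Proof.
exists (slope 0) => [|x]; first by have [] := exp_fun_along_ann 0.
suff -> : slope 0 = slope x by have [] := exp_fun_along_ann x.
have [q0 q0E] := exp_fun_poly w' 0 (f x).
have [q1 q1E] := exp_fun_poly w' (f a) (f x).
have qE t : (q1 - q0).[t] = slope (t *: x).
  rewrite hornerD hornerN q0E q1E add0r addrC /slope linearZ /=.
  by rewrite addrC [f a + _]addrC.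
have /size_poly1P[c _ qc] : size (q1 - q0) == 1%N.
  apply: contraT => /closed_rootP[t].
  by rewrite /root qE; have [/negPf ->] := exp_fun_along_ann (t *: x).
by rewrite -(scale0r x) -[in RHS](scale1r x) -!qE qc !hornerC.
Qed.

End ProportionalExp.

Section Polarization.
Variables (K : fieldType) (N : nuComAlgType K) (w : 'Hom(N, K^o)).
Implicit Types x y z : N.

Definition moment m x : K := w (unital_inj x ^+ m).2.

Let wsnd (u : unital_ext N) : K := w u.2.

Let wsndD u v : wsnd (u + v) = wsnd u + wsnd v.
Proof. exact: (linearD w). Qed.

Let wsndN u : wsnd (- u) = - wsnd u.
Proof. exact: (linearN w). Qed.

Let wsndMn u n : wsnd (u *+ n) = wsnd u *+ n.
Proof.
by elim: n => [|n IHn]; [apply: (linear0 w) | rewrite !mulrSr wsndD IHn].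
Qed.

Lemma polarize2 x y :
  w (x ** y) *+ 2 = moment 2 (x + y) - moment 2 x - moment 2 y.
Proof.
have momE m u : moment m u = wsnd (unital_inj u ^+ m) by [].
rewrite !momE raddfD /= -!wsndN -!wsndD.
rewrite -[w (x ** y)]/(wsnd (unital_inj (x ** y))) -unital_injM -wsndMn.
by congr wsnd; ring.
Qed.

Lemma polarize3 x y z :
  w (x ** y ** z) *+ 6 =
  moment 3 (x + y + z) - moment 3 (x + y) - moment 3 (x + z) - moment 3 (y + z)
  + moment 3 x + moment 3 y + moment 3 z.
Proof.
have momE m u : moment m u = wsnd (unital_inj u ^+ m) by [].
rewrite !momE !raddfD /= -!wsndN -!wsndD.
rewrite -[w _]/(wsnd (unital_inj (x ** y ** z))) -!unital_injM -wsndMn.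
by congr wsnd; ring.
Qed.

End Polarization.

Section EqualMoments.
Variables (C : numClosedFieldType) (N N' : nuComAlgType C).
Hypotheses (nilN : nilpotent_alg N) (nilN' : nilpotent_alg N').
Variable a' : N'.
Hypothesis annN' : ann N' = <[a']>%VS.
Variables (w : 'Hom(N, C^o)) (w' : 'Hom(N', C^o)).
Hypothesis wa' : w' a' = 1.
Variables (f : {linear N -> N'}) (c : C).
Hypothesis f_bij : bijective f.
Hypothesis f_exp : forall x, exp_fun w' (f x) = c * exp_fun w x.

Lemma exp_fun_moment m x : moment w' m (f x) = c * moment w m x.
Proof.
have [q qE qm] := exp_fun_scale w nilN x.
have [q' qE' qm'] := exp_fun_scale w' nilN' (f x).
have q'E : q' = c *: q.
  apply/eqP; rewrite -subr_eq0; apply: contraT => /closed_nonrootP[t].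
  by rewrite rootE hornerD hornerN hornerZ qE qE' -linearZ f_exp subrr eqxx.
have /eqP := qm' m; rewrite q'E coefZ qm mulrA => /eqP/mulIf-> //.
by rewrite invr_eq0 pnatr_eq0 -lt0n fact_gt0.
Qed.

(** Both f (x ** y) - f x ** f y and its products with elements of N' are killed
    by w', by the equalities of the first three moments. *)
Lemma moments_morph x y : f (x ** y) = f x ** f y.
Proof.
have w'1 z : w' (f z) = c * w z.
  by have := exp_fun_moment 1 z; rewrite /moment !expr1.
have w'2 u v : w' (f u ** f v) = c * w (u ** v).
  apply: (@mulIf _ 2%:R); first by rewrite pnatr_eq0.
  rewrite -mulrA !mulr_natr !polarize2 -linearD !exp_fun_moment; ring.
have w'3 u v t : w' (f u ** f v ** f t) = c * w (u ** v ** t).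
  apply: (@mulIf _ 6%:R); first by rewrite pnatr_eq0.
  rewrite -mulrA !mulr_natr !polarize3 -!linearD !exp_fun_moment; ring.
apply/eqP; rewrite -subr_eq0; apply/eqP.
apply: (ann_pairing_nondeg nilN' annN' (w := w')); first by rewrite wa' oner_eq0.
  by rewrite linearB /= w'1 w'2 subrr.
move=> z; have [g _ gK] := f_bij; rewrite -(gK z).
by rewrite amulDl -scaleN1r amulZl scaleN1r linearB /= w'2 w'3 subrr.
Qed.

End EqualMoments.

(** * Projections of a grading *)

Section Grading.
Variables (K : fieldType) (N : nuComAlgType K).

(** A grading is handled through its projections [e j], of which only the first
    [n] can be nonzero; [e 0] is included, and zero, so that degrees add up
    without shifts. *)
Definition graded_by n (e : nat -> 'End(N)) :=
  [/\ forall u, e 0%N u = 0,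
      forall u, \sum_(j < n) e j u = u,
      forall i j u, e i (e j u) = if i == j then e j u else 0
    & forall i j m u v,
        e i (e j u ** e m v) = if i == (j + m)%N then e j u ** e m v else 0].

Lemma grading_projections : has_grading N -> exists n e, graded_by n e.
Proof.
case=> G [dirG genG mulG].
have [n fullE] : exists n, fullv = (\sum_(i < n) G i.+1)%VS.
  have sumS m n : (m <= n)%N -> (\sum_(i < m) G i.+1 <= \sum_(i < n) G i.+1)%VS.
    move=> le_mn; rewrite -!(big_mkord xpredT (fun i => G i.+1)).
    by rewrite [X in (_ <= X)%VS](big_cat_nat (n := m)) //= addvSl.
  suff [n sGn] : exists n, forall u,
      u \in tval (vbasis {:N}) -> u \in (\sum_(i < n) G i.+1)%VS.
    exists n; apply/esym/vspaceP=> u; rewrite memvf; apply: (subvP _ u (memvf u)).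
    by rewrite -[X in (X <= _)%VS](span_basis (vbasisP _)); apply/span_subvP.
  elim: (tval (vbasis {:N})) => [|u s [n sGn]]; first by exists 0%N.
  have [m um] := genG u; exists (maxn m n) => v; rewrite inE => /predU1P[->|/sGn].
    exact: (subvP (sumS _ _ (leq_maxl _ _))).
  exact: (subvP (sumS _ _ (leq_maxr _ _))).
pose e k := if k is k'.+1 then oapp (sumv_pi_for fullE) 0 (insub k' : option 'I_n)
            else 0 : 'End(N).
have eG k u : (0 < k)%N -> e k u \in G k.
  case: k => // k _; rewrite /e; case: insubP => [i _ <- | _] /=.
    exact: memv_sum_pi.
  by rewrite zero_lfunE mem0v.
have e0 k u : (n < k)%N -> e k u = 0.
  by case: k => // k ltnk; rewrite /e insubN ?zero_lfunE // -leqNgt.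
have e00 u : e 0%N u = 0 by rewrite zero_lfunE.
have sum_ne u : \sum_(i < n) e i.+1 u = u.
  rewrite -[RHS](sumv_pi_sum fullE (memvf u)).
  by apply: eq_bigr => i _; rewrite /e valK.
clearbody e.
have sum_e m u : (n <= m)%N -> \sum_(i < m) e i.+1 u = u.
  move=> lenm; rewrite -(big_mkord xpredT (fun i => e i.+1 u)).
  rewrite (big_cat_nat (n := n)) //=.
  rewrite [X in _ + X]big1_seq ?addr0; last first.
    by move=> i; rewrite mem_index_iota => /andP[_ /andP[leni _]]; apply: e0.
  by rewrite big_mkord sum_ne.
have e_hom i j u : (0 < j)%N -> u \in G j -> e i u = if i == j then u else 0.
  case: i => [|i] j0 uGj; first by rewrite e00 eq_sym (negPf (lt0n_neq0 j0)).
  (* The number of components must cover i, j and the degrees generating N, as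
     the sum of the first m components is compared at both i and j. *)
  pose m := maxn n (maxn i.+1 j).
  have lei : (i < m)%N by rewrite /m !leq_max leqnn orbT.
  have lej : (j.-1 < m)%N by rewrite prednK // /m !leq_max leqnn !orbT.
  have := directv_sum_unique (dirG m); move/(_ (fun k => e k.+1 u)).
  move/(_ (fun k => if k.+1 == j then u else 0)) => uniq_e.
  have usG (k : 'I_m) : true -> e k.+1 u \in G k.+1 by move=> _; apply: eG.
  have vsG (k : 'I_m) : true -> (if k.+1 == j then u else 0) \in G k.+1.
    by move=> _; case: eqP => [->|_]; rewrite ?mem0v.
  have := uniq_e usG vsG; rewrite sum_e ?leq_maxl //.
  rewrite (bigD1 (Ordinal lej)) //= prednK // eqxx big1 => [|k]; last first.
    by rewrite -val_eqE /= => nek; rewrite -(prednK j0) eqSS (negPf nek).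
  by rewrite addr0 eqxx => /esym/forall_inP/(_ (Ordinal lei) isT)/eqP.
exists n.+1, e; split=> //.
- by move=> u; rewrite big_ord_recl e00 add0r sum_ne.
- move=> i [|j] u; last by apply: e_hom => //; apply: eG.
  by rewrite e00 linear0 if_same.
- move=> i [|j] [|m] u v; rewrite ?e00 ?amul0l ?amul0r ?linear0 ?if_same //.
  by apply: e_hom => //; apply: mulG => //; apply: eG.
Qed.

End Grading.

(** * Substitutions in a graded algebra *)

Section GradedSubstitution.
Variables (K : fieldType) (N : nuComAlgType K) (n : nat) (e : nat -> 'End(N)).
Hypothesis gradN : graded_by n e.
Implicit Types (u v x y : N).

Lemma graded_ge j u : (n <= j)%N -> e j u = 0.
Proof.
have [_ sum_e e_id _] := gradN => lenj; rewrite -(sum_e (e j u)) big1 // => i _.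
by rewrite e_id ltn_eqF // (leq_trans (ltn_ord i)).
Qed.

Lemma amul_suml I (r : seq I) (F : I -> N) y :
  (\sum_(i <- r) F i) ** y = \sum_(i <- r) F i ** y.
Proof.
by rewrite amulC linear_sum; apply: eq_bigr => i _; rewrite /= amulC.
Qed.

Definition unip v x := x + v ** x.

Lemma iter_unip_linear j v : linear (iter j (unip v)).
Proof.
elim: j => [//|j IHj] c x y; rewrite /= IHj /unip amulDr amulZr scalerDr.
by rewrite addrACA.
Qed.

Lemma iter_unip_mul j m v x y :
  iter j (unip v) x ** iter m (unip v) y = iter (j + m) (unip v) (x ** y).
Proof.
have unipMl i z t : iter i (unip v) z ** t = iter i (unip v) (z ** t).
  by elim: i => //= i IHi; rewrite {1}/unip amulDl -amulA IHi.
by rewrite unipMl amulC unipMl -iterD amulC.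
Qed.

(** Multiplication by (1 + v)^j on the component of degree j.  It is
    multiplicative because (1 + v)^(j + m) = (1 + v)^j (1 + v)^m. *)
Definition graded_subst_sum v x := \sum_(j < n) iter j (unip v) (e j x).

Lemma graded_subst_linear v : linear (graded_subst_sum v).
Proof.
move=> c x y; rewrite /graded_subst_sum scaler_sumr -big_split.
by apply: eq_bigr => j _; rewrite linearP iter_unip_linear.
Qed.

HB.instance Definition _ v :=
  GRing.isLinear.Build K N N _ (graded_subst_sum v) (graded_subst_linear v).

Definition graded_subst v : 'End(N) := linfun (graded_subst_sum v).

Lemma iter_unip0 j v : iter j (unip v) 0 = 0.
Proof. by elim: j => //= j ->; rewrite /unip amul0r addr0. Qed.

Lemma graded_subst_hom v j x :
  graded_subst v (e j x) = iter j (unip v) (e j x).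
Proof.
have [_ sum_e e_id _] := gradN; rewrite lfunE /= /graded_subst_sum.
have [ltjn | lenj] := ltnP j n; last first.
  rewrite (graded_ge _ lenj) iter_unip0 big1 // => i _.
  by rewrite linear0 iter_unip0.
rewrite (bigD1 (Ordinal ltjn)) //= e_id eqxx big1 ?addr0 // => i neij.
by rewrite e_id -[(_ == j)]/(i == Ordinal ltjn) (negPf neij) iter_unip0.
Qed.

Lemma graded_substM v x y :
  graded_subst v (x ** y) = graded_subst v x ** graded_subst v y.
Proof.
have [_ sum_e _ e_mul] := gradN.
have substE z : graded_subst v z = \sum_(j < n) iter j (unip v) (e j z).
  by rewrite lfunE.
rewrite (substE x) amul_suml -{1}(sum_e x) amul_suml linear_sum.
apply: eq_bigr => i _; rewrite (substE y) -{1}(sum_e y) !linear_sum.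
apply: eq_bigr => j _ /=; rewrite iter_unip_mul.
have -> : e i x ** e j y = e (i + j)%N (e i x ** e j y) by rewrite e_mul eqxx.
exact: graded_subst_hom.
Qed.

End GradedSubstitution.

Section NormalForm.
Variables (K : numFieldType) (N : nuComAlgType K) (n : nat) (e : nat -> 'End(N)).
Hypotheses (gradN : graded_by n e) (nilN : nilpotent_alg N).
Variable a : N.
Hypotheses (annN : ann N = <[a]>%VS) (a_neq0 : a != 0).
Implicit Types (w : 'Hom(N, K^o)) (u v x y : N).

Let ann_a y : a ** y = 0.
Proof. by apply/mem_annP: y; rewrite annN memv_line. Qed.

(** The annihilator is a graded subspace, and of dimension 1. *)
Lemma ann_degree : exists d, e d a = a.
Proof.
have [_ sum_e e_id e_mul] := gradN.
have [d ea0] : exists d, e d a != 0.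
  apply: contrapT => /forallNP e0; move: a_neq0.
  rewrite -(sum_e a) big1 ?eqxx // => i _.
  by have /negP := e0 i; rewrite negbK => /eqP.
exists d; suff /vlineP[k eak] : e d a \in <[a]>%VS.
  have k0 : k != 0 by apply: contra ea0 => /eqP k0; rewrite eak k0 scale0r.
  have := e_id d d a; rewrite eqxx eak linearZ /= eak.
  by move/(scalerI k0).
rewrite -annN; apply/mem_annP => v; rewrite -(sum_e v) linear_sum big1 // => m _ /=.
have : e (d + m)%N (a ** e m v) = 0 by rewrite ann_a linear0.
rewrite -{1}(sum_e a) amul_suml linear_sum /=.
have [ltdn|/(graded_ge gradN) ed0] := ltnP d n; last by rewrite ed0 amul0l.
rewrite (bigD1 (Ordinal ltdn)) //= e_mul eqxx big1 ?addr0 // => i neid.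
by rewrite e_mul eqn_add2r eq_sym -[(_ == d)]/(i == Ordinal ltdn) (negPf neid).
Qed.

Variable d : nat.
Hypothesis ed_a : e d a = a.

(** A nonzero homogeneous element has a nonzero multiple, of at least the same
    degree, in the annihilator. *)
Lemma graded_gt_top j u : (d < j)%N -> e j u = 0.
Proof.
have [_ sum_e e_id e_mul] := gradN => ltdj; apply/eqP; apply: contraT.
case/(ann_meets nilN)=> b []; rewrite annN => /vlineP[k bE] b0.
have edb : e d b = b by rewrite bE linearZ /= ed_a.
case=> [bj | [y bj]]; move: b0; rewrite -edb bj.
  by rewrite e_id ltn_eqF // eqxx.
rewrite -(sum_e y) !linear_sum big1 ?eqxx // => m _ /=.
by rewrite e_mul ltn_eqF // ltn_addr.
Qed.

Lemma graded_top_ann u : e d u \in ann N.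
Proof.
have [e0 sum_e e_id e_mul] := gradN; apply/mem_annP => v.
rewrite -(sum_e v) linear_sum big1 // => -[[|m] ltm] _ /=.
  by rewrite e0 amul0r.
have <- : e (d + m.+1)%N (e d u ** e m.+1 v) = e d u ** e m.+1 v.
  by rewrite e_mul eqxx.
by apply: graded_gt_top; rewrite addnS ltnS leq_addr.
Qed.

Variable w0 : 'Hom(N, K^o).
Hypotheses (w0a : w0 a = 1) (w0_top : forall j u, j != d -> w0 (e j u) = 0).

(** The difference of w0 and w on the component of degree m vanishes on the
    annihilator, so it is w0 (v ** _) for some v, and only the component of v of
    degree d - m counts.  The substitution by u, this component divided by m,
    maps x of degree m to (1 + u)^m x = x + m (u ** x), because u ** x is in the
    top degree; higher components are fixed, since their products with u would
    have degree above d. *)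
Lemma graded_normal_step w m :
  (0 < m < d)%N -> w a = 1 ->
  (forall j x, (m < j)%N -> w (e j x) = w0 (e j x)) ->
  exists2 f : 'End(N), (forall x y, f (x ** y) = f x ** f y) &
    forall j x, (m <= j)%N -> w (f (e j x)) = w0 (e j x).
Proof.
have [e0 sum_e e_id e_mul] := gradN.
move=> /andP[m0 ltmd] wa w_w0; pose k := (d - m)%N.
have kmd : (k + m = d)%N by rewrite subnK // ltnW.
have [v vE] : exists v, forall x, ((w0 - w) \o e m)%VF x = w0 (v ** x).
  apply: (ann_pairing_onto nilN annN w0a); rewrite comp_lfunE /= -ed_a e_id.
  by rewrite ltn_eqF // linear0.
pose u := e k (m%:R^-1 *: v).
exists (graded_subst n e u); first exact: graded_substM.
have u_top j x : (m < j)%N -> u ** e j x = 0.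
  move=> ltmj; have <- : e (k + j)%N (u ** e j x) = u ** e j x.
    by rewrite e_mul eqxx.
  by apply: graded_gt_top; rewrite -kmd ltn_add2l.
move=> j x; rewrite leq_eqVlt graded_subst_hom // => /predU1P[<-{j} | ltmj];
  last first.
  suff -> : iter j (unip u) (e j x) = e j x by apply: w_w0.
  by elim: {1}j => //= i ->; rewrite /unip u_top ?addr0.
have uue : u ** (u ** e m x) = 0.
  have -> : u ** e m x = e d (u ** e m x) by rewrite e_mul kmd eqxx.
  by rewrite amulC; apply/mem_annP/graded_top_ann.
have -> i : iter i (unip u) (e m x) = e m x + i%:R *: (u ** e m x).
  elim: i => [|i IHi] /=; first by rewrite scale0r addr0.
  rewrite IHi /unip amulDr amulZr uue scaler0 addr0 -natr1 scalerDl scale1r.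
  by rewrite addrA.
have -> : m%:R *: (u ** e m x) = e k v ** e m x.
  by rewrite /u linearZ /= amulZl scalerA divff ?scale1r // pnatr_eq0 -lt0n.
have w0v : w0 (e k v ** e m x) = w0 (v ** e m x).
  rewrite -{2}(sum_e v) amul_suml linear_sum.
  have w0i i : i != k -> w0 (e i v ** e m x) = 0.
    move=> neik; have <- : e (i + m)%N (e i v ** e m x) = e i v ** e m x.
      by rewrite e_mul eqxx.
    by apply: w0_top; rewrite -kmd eqn_add2r.
  have [ltkn | lenk] := ltnP k n; last first.
    rewrite (graded_ge gradN) // amul0l linear0 big1 // => i _ /=.
    by rewrite w0i // ltn_eqF // (leq_trans (ltn_ord i)).
  by rewrite (bigD1 (Ordinal ltkn)) //= big1 ?addr0 // => i neik; apply: w0i.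
have -> : w (e m x + e k v ** e m x) = w (e m x) + w0 (v ** e m x).
  rewrite linearD -w0v; congr (_ + _).
  have -> : e k v ** e m x = e d (e k v ** e m x) by rewrite e_mul kmd eqxx.
  exact: w_w0.
by rewrite -vE comp_lfunE /= e_id eqxx add_lfunE opp_lfunE addrC subrK.
Qed.

Lemma graded_normal_form w : w a = 1 ->
  exists2 f : 'End(N), (forall x y, f (x ** y) = f x ** f y) &
    forall x, w (f x) = w0 x.
Proof.
have [e0 sum_e e_id e_mul] := gradN => wa.
suff [f fM wf] : exists2 f : 'End(N), (forall x y, f (x ** y) = f x ** f y) &
    forall j x, (0 < j)%N -> w (f (e j x)) = w0 (e j x).
  exists f => // x; rewrite -(sum_e x) !linear_sum.
  apply: eq_bigr => -[[|j] ltj] _ /=; last exact: wf.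
  by rewrite e0 !linear0.
suff H k : (k < d)%N -> exists2 f : 'End(N), (forall x y, f (x ** y) = f x ** f y) &
    forall j x, (d - k <= j)%N -> w (f (e j x)) = w0 (e j x).
  have d0 : (0 < d)%N.
    by rewrite lt0n; apply: contra a_neq0 => /eqP d0; rewrite -ed_a d0 e0.
  have [|f fM wf] := H d.-1; first by rewrite prednK.
  exists f => // j x j0; apply: wf.
  by rewrite -{1}(prednK d0) subSn // subnn.
elim: k => [|k IHk] ltkd.
  exists \1%VF => [x y | j x]; first by rewrite !id_lfunE.
  rewrite subn0 leq_eqVlt id_lfunE => /predU1P[<-|ltdj]; last first.
    by rewrite graded_gt_top // !linear0.
  have := graded_top_ann x; rewrite annN => /vlineP[c ->].
  by rewrite !linearZ /= wa w0a.
have [f fM wf] := IHk (ltnW ltkd).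
have [||j x ltj|g gM wg] := @graded_normal_step (w \o f)%VF (d - k.+1)%N.
- by rewrite subn_gt0 ltkd ltn_subrL (leq_trans _ ltkd).
- by rewrite comp_lfunE -ed_a wf ?leq_subr // ed_a w0a.
- by rewrite comp_lfunE wf // -subSS subSn // ltnW.
exists (f \o g)%VF => [x y | j x ltj]; first by rewrite !comp_lfunE /= gM fM.
by rewrite comp_lfunE -wg // comp_lfunE.
Qed.

End NormalForm.

(** * The hypersurfaces of isomorphic algebras *)

Section IsoToLinear.
Variables (K : numFieldType) (N N' : nuComAlgType K).

Lemma admissible_projection_functional (M : nuComAlgType K) (p : 'End(M)) a :
  ann M = <[a]>%VS -> a != 0 -> admissible_projection p ->
  exists2 w : 'Hom(M, K^o), w a = 1 & forall x, p x = w x *: a.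
Proof.
move=> annM a0 [pp imp].
have pa x : p x \in <[a]>%VS by rewrite -annM -imp memv_img ?memvf.
have [w wE] := line_coord a0 pa; exists w => //.
have /memv_imgP[b _ ab] : a \in limg p by rewrite imp annM memv_line.
have := wE a; rewrite {1}ab -[p (p b)]comp_lfunE pp -ab -{1}[a]scale1r.
move/eqP; rewrite -subr_eq0 -scalerBl scaler_eq0 (negPf a0) orbF subr_eq0.
by rewrite eq_sym => /eqP.
Qed.

(** The exponential is natural in the algebra. *)
Lemma Shyper_transport (p : 'End(N)) (p' : 'End(N')) (psi : {linear N -> N'}) :
  nilpotent_alg N -> nilpotent_alg N' ->
  bijective psi -> (forall x y, psi (x ** y) = psi x ** psi y) ->
  (forall x, p x = 0 <-> p' (psi x) = 0) -> (psi @` Shyper p = Shyper p')%classic.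
Proof.
move=> nilN nilN' psi_bij psiM psi_p.
have [g psiK gK] := psi_bij.
have eq_dim : \dim {:N} = \dim {:N'}.
  have <- : limg (linfun psi) = fullv.
    apply/vspaceP => x; rewrite memvf -[x]gK -[psi _]lfunE memv_img ?memvf //.
  rewrite limg_dim_eq //.
  apply/eqP; rewrite capfv; apply/lker0P => x y.
  by rewrite !lfunE /=; apply: (can_inj psiK).
have psi_horner x q : (horner_alg (unital_inj (psi x)) q).2 =
    psi (horner_alg (unital_inj x) q).2.
  elim/poly_ind: q => [|q c IHq]; first by rewrite !rmorph0 -[RHS]/(psi 0) linear0.
  rewrite !rmorphD !rmorphM /= !horner_algX !horner_algC.
  set z' := horner_alg _ q in IHq *; set z := horner_alg (unital_inj x) q in IHq *.
  have z1 : z'.1 = z.1 by rewrite !fst_horner_alg.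
  rewrite -[LHS]/(z'.1 *: psi x + 0 *: z'.2 + z'.2 ** psi x + c *: 0).
  rewrite -[RHS]/(psi (z.1 *: x + 0 *: z.2 + z.2 ** x + c *: 0)).
  by rewrite z1 IHq -psiM !scale0r !scaler0 !addr0 linearD linearZ.
have SE x : Shyper p x <-> Shyper p' (psi x).
  by rewrite !Shyper_exp // -linearZ /uexp -eq_dim psi_horner psi_p.
apply/seteqP; split=> [_ [x /SE Sx <-] // | y]; rewrite -[y]gK => /SE Sy.
by exists (g y).
Qed.

Lemma bij_linear_inv (U V : vectType K) (f : {linear U -> V}) :
  bijective f -> exists2 g : {linear V -> U}, cancel f g & cancel g f.
Proof.
case=> g fK gK.
by exists (HB.pack_for {linear V -> U} g
  (GRing.isLinear.Build K V U _ g (can2_linear fK gK))).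
Qed.

(** The kernel of f is an ideal on which w0 vanishes. *)
Lemma endo_injective (w0 w : 'Hom(N, K^o)) (f : 'End(N)) a :
  nilpotent_alg N -> ann N = <[a]>%VS -> w0 a != 0 ->
  (forall x y, f (x ** y) = f x ** f y) -> (forall x, w (f x) = w0 x) ->
  lker f == 0%VS.
Proof.
move=> nilN annN w0a fM wf; rewrite -subv0; apply/subvP => x.
rewrite memv_ker memv0 => /eqP fx0; apply/eqP.
apply: (ann_pairing_nondeg nilN annN w0a) => [|y].
  by rewrite -wf fx0 linear0.
by rewrite -wf fM fx0 amul0l linear0.
Qed.

(** Both functionals have the same normal form, the one that agrees with w1 in
    the degree of the annihilator and vanishes in all others. *)
Lemma graded_functional_transitive (w1 w2 : 'Hom(N, K^o)) a :
  nilpotent_alg N -> ann N = <[a]>%VS -> a != 0 -> has_grading N ->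
  w1 a = 1 -> w2 a = 1 ->
  exists2 h : {linear N -> N}, bijective h &
    (forall x y, h (x ** y) = h x ** h y) /\ forall x, w2 (h x) = w1 x.
Proof.
move=> nilN annN a0 /grading_projections[n [e gradN]] w1a w2a.
have [d ed_a] := ann_degree gradN annN a0.
pose w0 := (w1 \o e d)%VF; have [_ _ e_id _] := gradN.
have w0a : w0 a = 1 by rewrite comp_lfunE /= ed_a.
have w0_top j u : j != d -> w0 (e j u) = 0.
  by move=> nejd; rewrite comp_lfunE /= e_id eq_sym (negPf nejd) linear0.
have w0a_neq0 : w0 a != 0 by rewrite w0a oner_eq0.
have normal := graded_normal_form gradN nilN annN a0 ed_a w0a w0_top.
have [f1 f1M wf1] := normal _ w1a; have [f2 f2M wf2] := normal _ w2a.
have k1 := endo_injective nilN annN w0a_neq0 f1M wf1.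
have k2 := endo_injective nilN annN w0a_neq0 f2M wf2.
have f1V x : f1 (f1^-1%VF x) = x by apply: lker0_lfunVK.
exists (f2 \o f1^-1)%VF.
  exists (f1 \o f2^-1)%VF => x; rewrite /= !comp_lfunE.
    by rewrite lker0_lfunK // f1V.
  by rewrite lker0_lfunK // lker0_lfunVK.
split=> x *; rewrite /= !comp_lfunE; last first.
  by rewrite wf2 -wf1 f1V.
rewrite -f2M; congr (f2 _); apply: (lker0P k1).
by rewrite f1M !f1V.
Qed.

(** Pull the coordinate of p' back to N, and correct the given isomorphism by an
    automorphism of N that takes it to the coordinate of p. *)
Lemma graded_iso_linear (p : 'End(N)) (p' : 'End(N')) :
  admissible N -> admissible N' ->
  admissible_projection p -> admissible_projection p' -> has_grading N ->
  alg_isomorphic N N' -> lin_equivalent (Shyper p) (Shyper p').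
Proof.
move=> [nilN /dim1_line[a a0 annN]] [nilN' dimN'] pP pP' gradN [phi phi_bij phiM].
have [g phiK gK] := phi_bij.
have phia0 : phi a != 0.
  by apply: contra a0 => /eqP phia0; rewrite -(inj_eq (can_inj phiK)) phia0 linear0.
have annN' : ann N' = <[phi a]>%VS.
  apply/esym/eqP; rewrite eqEdim dimN' dim_vline phia0 andbT -memvE.
  apply/mem_annP => v; rewrite -[v]gK -phiM.
  have /mem_annP -> : a \in ann N by rewrite annN memv_line.
  by rewrite linear0.
have [w wa pE] := admissible_projection_functional annN a0 pP.
have [w' wa' pE'] := admissible_projection_functional annN' phia0 pP'.
have [||h h_bij [hM hw]] := graded_functional_transitive (w1 := w)
    (w2 := (w' \o linfun phi)%VF) nilN annN a0 gradN.
- by [].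
- by rewrite comp_lfunE lfunE.
have psi_bij : bijective (phi \o h) by apply: bij_comp.
exists (phi \o h) => //; apply: Shyper_transport => // [x y | x] /=.
  by rewrite hM phiM.
have w'E : w' (phi (h x)) = w x by rewrite -hw comp_lfunE lfunE.
rewrite pE pE' w'E; split=> /eqP; rewrite scaler_eq0.
  by rewrite (negPf a0) orbF => /eqP->; rewrite scale0r.
by rewrite (negPf phia0) orbF => /eqP->; rewrite scale0r.
Qed.

End IsoToLinear.

Section LinearToIso.
Variables (C : numClosedFieldType) (N N' : nuComAlgType C).

Lemma linear_equivalent_iso (p : 'End(N)) (p' : 'End(N')) :
  admissible N -> admissible N' ->
  admissible_projection p -> admissible_projection p' ->
  lin_equivalent (Shyper p) (Shyper p') -> alg_isomorphic N N'.
Proof.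
move=> [nilN /dim1_line[a a0 annN]] [nilN' /dim1_line[a' a0' annN']].
move=> pP pP' [f f_bij fS].
have [w wa pE] := admissible_projection_functional annN a0 pP.
have [w' wa' pE'] := admissible_projection_functional annN' a0' pP'.
have SE (M : nuComAlgType C) (q : 'End(M)) (v : 'Hom(M, C^o)) b x :
    nilpotent_alg M -> b != 0 -> (forall y, q y = v y *: b) ->
    Shyper q (2%:R^-1 *: x) <-> exp_fun v x = 0.
  move=> nilM b0 qE; rewrite Shyper_exp // scalerA divff ?pnatr_eq0 // scale1r.
  rewrite qE; split=> [/eqP|]; last by rewrite /exp_fun => ->; rewrite scale0r.
  by rewrite scaler_eq0 (negPf b0) orbF => /eqP.
have [g fK gK] := f_bij.
have f_zeros x : exp_fun w x = 0 <-> exp_fun w' (f x) = 0.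
  rewrite -(SE _ _ _ _ _ nilN a0 pE) -(SE _ _ _ _ _ nilN' a0' pE') -linearZ -fS.
  by split=> [Sx | [y Sy /(can_inj fK) <-]//]; exists (2%:R^-1 *: x).
have [c _ fc] := exp_fun_proportional annN annN' wa wa' f_bij f_zeros.
by exists f => // x y; apply: (moments_morph nilN nilN' annN' wa' f_bij fc).
Qed.

End LinearToIso.

Theorem corollary2p5 (R : realType) (N N' : nuComAlgType R[i])
    (p : 'End(N)) (p' : 'End(N')) :
  admissible N -> admissible N' ->
  admissible_projection p -> admissible_projection p' ->
  has_grading N \/ has_grading N' ->
  alg_isomorphic N N' <-> lin_equivalent (Shyper p) (Shyper p').
Proof.
move=> admN admN' pP pP' gradNN'; split; last exact: linear_equivalent_iso.
case: gradNN' => [gradN | gradN'] isoNN'; first exact: graded_iso_linear.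
have [f f_bij fM] := isoNN'; have [g fK gK] := bij_linear_inv f_bij.
have g_bij : bijective g by exists f.
have [||||||h h_bij hS] :=
  graded_iso_linear (N := N') (N' := N) (p := p') (p' := p).
1-5: by [].
- by exists g => // x y; apply: (can_inj fK); rewrite fM !gK.
have [k hK kK] := bij_linear_inv h_bij; exists k; first by exists h.
rewrite -hS; apply/seteqP; split=> [_ [_ [x Sx <-] <-] | x Sx]; first by rewrite hK.
by exists (h x); [exists x | rewrite hK].
Qed.
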